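(* Let $p>1$ be an integer and let $u^{(p)}$ be the fixed point of the substitution $\varphi_p(L)=L^pS$, $\varphi_p(S)=M$, $\varphi_p(M)=L^{p-1}S$, with Abelian complexity $\mathrm{AC}$. (i) $\mathrm{AC}(n)\le 7$ for all $n\in\mathbb N$. (ii) The bound $7$ cannot be improved; moreover, there are infinitely many $n\in\mathbb N$ such that $\mathrm{AC}(n)=7$.
   Context: $u^{(p)}=\lim_{n\to\infty}\varphi_p^n(L)$. For a finite word $w$, its Parikh vector is $\Psi(w)=(|w|_L,|w|_S,|w|_M)$, where $|w|_a$ is the number of occurrences of $a$ in $w$. The Abelian complexity of $u^{(p)}$ is $\mathrm{AC}(n)=\#\{\Psi(w): w \text{ a factor of } u^{(p)} \text{ of length } n\}$. *)

(* Defs.v *)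
From HB Require Import structures.
From mathcomp Require Import all_boot.
From mathcomp Require Import boolp.
Set Implicit Arguments. Unset Strict Implicit. Unset Printing Implicit Defensive.

Inductive letter := L | S | M.

Definition letter_eqb (a b : letter) : bool :=
  match a, b with L, L | S, S | M, M => true | _, _ => false end.
Lemma letter_eqP : Equality.axiom letter_eqb.
Proof. by case; case; constructor. Qed.
HB.instance Definition _ := hasDecEq.Build letter letter_eqP.

Definition phi (p : nat) (a : letter) : seq letter :=
  match a with
  | L => rcons (nseq p L) S
  | S => [:: M]
  | M => rcons (nseq p.-1 L) S
  end.

Definition phiw (p : nat) (w : seq letter) : seq letter := flatten (map (phi p) w).

Definition phin (p n : nat) : seq letter := iter n (phiw p) [:: L].

(* The fixed point u^(p) = lim phi_p^n(L), as an infinite word nat -> letter: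
   its i-th letter is the i-th letter of phi_p^(i+1)(L); for p > 1 each
   phi_p^n(L) is a prefix of phi_p^(n+1)(L) and has length > n, so this is
   the limit word. *)
Definition u (p : nat) (i : nat) : letter := nth L (phin p i.+1) i.

Definition factor (p i n : nat) : seq letter := [seq u p (i + k) | k <- iota 0 n].

Definition parikh (w : seq letter) : nat * nat * nat :=
  (count_mem L w, count_mem S w, count_mem M w).

(* Abelian complexity AC(n) = number of Parikh vectors of length-n factors.
   Every such vector has entries <= n, so they are enumerated inside
   'I_(n+1)^3. *)
Definition abelian_complexity (p n : nat) : nat :=
  #|[set v : 'I_n.+1 * 'I_n.+1 * 'I_n.+1 |
      `[< exists i, parikh (factor p i n)
                    = (nat_of_ord v.1.1, nat_of_ord v.1.2, nat_of_ord v.2) >] ]|.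

(* Main.v *)
(* Compare two factors of [u] through the differences (n, s, m) of their lengths and of their
   numbers of S and M.  Desubstituting both factors turns (n, s, m) into
   (s + m, m, (p + 1) s + m - n + e) with |e| <= 2p, so an invariant region in the window
   |n| <= 3 is propagated by induction on the positions of the factors.  For n = 0 it says
   |s| <= 2, |m| <= 2, and m <= 0 as soon as s = 2; at most 7 vectors have pairwise differences
   of this kind.  Conversely 7 factors of one length n(N) are written down explicitly, as
   differences of prefixes coded in the numeration system of the substitution; adding any
   prefix u_0 ... u_(N-1) with u_N = L as a leading digit increases n without changing their
   relative Parikh vectors. *)
From Stdlib Require Import ZArith Lia.
Require Import Defs.
From mathcomp Require Import all_boot boolp zify.
Set Implicit Arguments. Unset Strict Implicit. Unset Printing Implicit Defensive.


(** * Prefixes of the fixed point and their images *)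

Lemma phiw_cat p a b : phiw p (a ++ b) = phiw p a ++ phiw p b.
Proof. by rewrite /phiw map_cat flatten_cat. Qed.

Lemma phinS p n : phin p n.+1 = phiw p (phin p n).
Proof. by []. Qed.

Lemma prefix_phin p m n : 0 < p -> m <= n -> prefix (phin p m) (phin p n).
Proof.
move=> p_gt0 /subnK <-; elim: (n - m) => [|k IHk]; first exact: prefix_refl.
apply: prefix_trans IHk _; rewrite addSn; elim: (k + m) => [|j /prefixP[t def_t]].
  by case: p p_gt0 => // p _; rewrite /= prefix0s.
by rewrite [phin p j.+1]phinS [phin p j.+2]phinS def_t phiw_cat prefix_prefix.
Qed.

Lemma size_phi p a : 1 < p -> 0 < size (phi p a).
Proof. by case: a => //= _; rewrite size_rcons. Qed.

Lemma size_phiw_ge p w : 1 < p -> size w <= size (phiw p w).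
Proof.
move=> hp; elim: w => //= a w IHw; rewrite -cat1s phiw_cat size_cat.
by rewrite -addn1 addnC leq_add // /phiw /= cats0 size_phi.
Qed.

Lemma ltn_size_phin p n : 1 < p -> n < size (phin p n).
Proof.
move=> hp; elim: n => // n IHn.
have /prefixP[t def_t]: prefix (phin p 0) (phin p n) by apply: prefix_phin => //; lia.
rewrite phinS def_t phiw_cat size_cat; have := size_phiw_ge t hp.
by rewrite def_t size_cat /phin /phiw /= cats0 size_rcons size_nseq in IHn *; lia.
Qed.

Lemma u_phin p n i : 1 < p -> i < size (phin p n) -> u p i = nth L (phin p n) i.
Proof.
move=> hp lt_i; have lt_i' : i < size (phin p i.+1) by apply: ltnW; apply: ltn_size_phin.
have p_gt0 : 0 < p by lia.
rewrite /u; have [le_n|/ltnW le_n] := leqP n i.+1.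
  have /prefixP[t ->] := prefix_phin p_gt0 le_n; by rewrite nth_cat lt_i.
have /prefixP[t ->] := prefix_phin p_gt0 le_n; by rewrite nth_cat lt_i'.
Qed.

Definition pre p n := mkseq (u p) n.

Lemma pre_phin p n : 1 < p -> pre p (size (phin p n)) = phin p n.
Proof.
move=> hp; apply: (@eq_from_nth _ L) => [|i]; rewrite size_mkseq // => lt_i.
by rewrite nth_mkseq // -u_phin.
Qed.

Lemma pre_cat p m n : pre p (m + n) = pre p m ++ factor p m n.
Proof.
rewrite /pre /mkseq iotaD map_cat /factor; congr (_ ++ _).
by rewrite -[in iota (0 + m)](addn0 m) add0n iotaDl -map_comp.
Qed.

Lemma take_pre p m n : m <= n -> take m (pre p n) = pre p m.
Proof.
by move=> /subnKC <-; rewrite pre_cat -[X in take X _](size_mkseq (u p) m) take_size_cat.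
Qed.

(* [pre p n] is a prefix of [phin p n], whose image [phin p n.+1] is again a prefix of [u]. *)
Lemma phiw_pre p n : 1 < p -> phiw p (pre p n) = pre p (size (phiw p (pre p n))).
Proof.
move=> hp; have le_n : n <= size (phin p n) by apply/ltnW/ltn_size_phin.
have def_phin : phin p n.+1 = phiw p (pre p n) ++ phiw p (drop n (phin p n)).
  by rewrite phinS -{1}(cat_take_drop n (phin p n)) phiw_cat -{1}(pre_phin n hp) take_pre.
have le_size : size (phiw p (pre p n)) <= size (phin p n.+1).
  by rewrite def_phin size_cat leq_addr.
by rewrite -[RHS](take_pre _ le_size) pre_phin // def_phin take_size_cat.
Qed.

(** * Letter counts of prefixes and desubstitution of positions *)

Definition cnt p a n := count_mem a (pre p n).

Lemma cnt_factor p a i n : cnt p a (i + n) = cnt p a i + count_mem a (factor p i n).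
Proof. by rewrite /cnt pre_cat count_cat. Qed.

Lemma cntS p a n : cnt p a n.+1 = cnt p a n + (u p n == a).
Proof. by rewrite -addn1 cnt_factor /= addn0 addn0. Qed.

Lemma count_letters (w : seq letter) : count_mem L w + count_mem S w + count_mem M w = size w.
Proof. by elim: w => // -[] w /=; rewrite -?[_ == _]/false -?[_ == _]/true; lia. Qed.

Lemma count_phiw p w : 1 < p -> let c a := count_mem a w in
  [/\ count_mem S (phiw p w) = c L + c M, count_mem M (phiw p w) = c S
    & size (phiw p w) = p.+1 * c L + c S + p * c M].
Proof.
move=> hp /=; elim: w => [|a w [IHS IHM IHn]]; first by split => //=; lia.
rewrite -cat1s phiw_cat !count_cat !size_cat IHS IHM IHn.
by case: a; rewrite /phiw /= ?cats0 -?cats1 ?count_cat ?count_nseq ?size_cat ?size_nseq /=;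
  split; lia.
Qed.

(** S and M occur only as last letters of images, so a proper prefix of an image is a power of L. *)
Lemma count_take_phi p a b r : r < size (phi p b) -> a != L -> count_mem a (take r (phi p b)) = 0.
Proof.
move=> lt_r neq_a; suff ->: take r (phi p b) = nseq r L by rewrite count_nseq; case: a neq_a.
case: b lt_r => /=; rewrite ?size_rcons ?size_nseq ltnS => le_r; last 2 first.
- by move: le_r; rewrite leqn0 => /eqP->.
- by rewrite -cats1 takel_cat ?size_nseq // take_nseq.
- by rewrite -cats1 takel_cat ?size_nseq // take_nseq.
Qed.

(** Position [i] is place [r] in the image of the letter at [N]. The equations are those of
    [count_phiw] for the prefix before [N], with the count of L eliminated and without subtraction
    in [nat]. *)
Definition child_of p N r i : Prop :=
  [/\ r < size (phi p (u p N)), i + p * cnt p S N + cnt p M N = p.+1 * N + r,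
      cnt p S i + cnt p S N = N, cnt p M i = cnt p S N & u p i = nth L (phi p (u p N)) r].

Lemma pre_block p N : 1 < p ->
  pre p (size (phiw p (pre p N.+1))) = phiw p (pre p N) ++ phi p (u p N).
Proof.
by move=> hp; rewrite -phiw_pre // -addn1 pre_cat phiw_cat /phiw /= addn0 cats0.
Qed.

Lemma block_child p N r : 1 < p -> r < size (phi p (u p N)) ->
  child_of p N r (size (phiw p (pre p N)) + r).
Proof.
move=> hp lt_r; set k := size (phiw p (pre p N)).
have def_k : size (phiw p (pre p N.+1)) = k + size (phi p (u p N)).
  by rewrite -(size_mkseq (u p) (size _)) -[mkseq _ _]/(pre p _) pre_block // size_cat.
have def_pre := pre_block N hp; rewrite def_k in def_pre.
have pre_i : pre p (k + r) = phiw p (pre p N) ++ take r (phi p (u p N)).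
  by rewrite -(@take_pre p _ (k + size (phi p (u p N)))) ?leq_add2l 1?ltnW //
    def_pre take_cat ltnNge leq_addr addKn.
have [cS cM ck] := count_phiw (pre p N) hp.
have := count_letters (pre p N); rewrite size_mkseq -!/(cnt _ _ _) in cS cM ck * => cN.
split=> //; first by rewrite /k ck; lia.
- by rewrite {1}/cnt pre_i count_cat cS count_take_phi //; lia.
- by rewrite {1}/cnt pre_i count_cat cM count_take_phi //; lia.
have -> : u p (k + r) = nth L (pre p (k + size (phi p (u p N)))) (k + r).
  by rewrite nth_mkseq // ltn_add2l.
by rewrite def_pre nth_cat ltnNge leq_addr /= addKn.
Qed.

Lemma has_parent p i : 1 < p -> exists N r, child_of p N r i.
Proof.
move=> hp; suff [N [r [lt_r ->]]] : exists N r,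
    r < size (phi p (u p N)) /\ i = size (phiw p (pre p N)) + r.
  by exists N, r; apply: block_child.
elim: i => [|i [N [r [lt_r ->]]]]; first by exists 0, 0; split=> //; exact: size_phi.
have [lt_r1|le_r1] := ltnP r.+1 (size (phi p (u p N))); first by exists N, r.+1; rewrite addnS.
exists N.+1, 0; split; first exact: size_phi.
rewrite -(size_mkseq (u p) (size (phiw p (pre p N.+1)))) -[mkseq _ _]/(pre p _) pre_block //.
by rewrite size_cat; lia.
Qed.

Lemma u0 p : 1 < p -> u p 0 = L.
Proof. by case: p => [|[]]. Qed.

Lemma cntL_gt0 p n : 1 < p -> 0 < n -> 0 < cnt p L n.
Proof.
move=> hp; elim: n => // n IHn _; rewrite cntS; case: n IHn => [_|n IHn].
  by rewrite u0 // addn1.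
by rewrite ltn_addr ?IHn.
Qed.

Lemma cnt_sum p n : cnt p L n + cnt p S n + cnt p M n = n.
Proof. by rewrite count_letters size_mkseq. Qed.

(** Only the image of L has a place [p], and the image of S has neither a place [r > 0] nor an L.
    The last clauses make positions decrease in the induction. *)
Lemma parentP p i : 1 < p -> exists N r, let d := nat_of_bool (u p N == M) in
  i + p * cnt p S N + cnt p M N = p.+1 * N + r /\ cnt p S i + cnt p S N = N /\
  cnt p M i = cnt p S N /\ r <= p /\
  (r = p -> u p N = L) /\ (u p i = L -> cnt p S N.+1 = cnt p S N) /\
  (0 < r -> cnt p S N.+1 = cnt p S N /\ cnt p M N.+1 = cnt p M N + d /\ r + d <= p /\ N < i) /\
  N <= i /\ (0 < i -> N < i) /\ (1 < i -> N.+1 < i).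
Proof.
move=> hp; have [N [r [lt_r i_eq S_eq M_eq u_i]]] := has_parent i hp.
exists N, r => d; have sumN := cnt_sum p N.
have LN : 0 < N -> 0 < cnt p L N by apply: cntL_gt0.
have nN : i = N + p * cnt p L N + p.-1 * cnt p M N + r by nia.
have leN : 0 < N -> N + p <= i by move/LN; nia.
rewrite /d !cntS; case: (u p N) lt_r u_i => /=; rewrite ?size_rcons ?size_nseq => lt_r u_i;
  do ![split=> //]; try lia.
by rewrite u_i; case: (r) lt_r.
Qed.

(** * Integer inequalities for the invariant region *)

Local Open Scope Z_scope.

(* [(p + 1) s + m - n] is, up to an error of at most [2p], the difference of the numbers of M one
   level up: the first inequality is what the bound [2] on that difference implies. *)
Definition window (p n s m : Z) : Prop :=
  (p + 1) * s + m <= n + 2 * p + 2 /\ s <= 3 /\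
  (m <= 2 \/ m = 3 /\ 1 <= n /\ s <= n - 2) /\
  (2 <= s -> -1 <= n) /\ (3 <= s -> 2 <= n).

(* The second clause is what [window] at [n = 3] implies after adding [n - 3] more letters. *)
Definition upper (p n s m : Z) : Prop :=
  (-3 <= n <= 3 -> window p n s m) /\
  (3 <= n -> m <= n /\ (p + 1) * s + m <= 2 * p + 5 + (p + 1) * (n - 3)).

Definition both (p n s m : Z) : Prop := upper p n s m /\ upper p (- n) (- s) (- m).

(** The crude bound 4, read off a difference one letter away, leaves finitely many pairs [(s, m)]
    for [window_desubst]. *)
Lemma neighbour_bounds p n s m a b e : 2 <= p -> -3 <= n <= 3 -> -3 <= n + e <= 3 ->
  -1 <= a <= 1 -> -1 <= b <= 1 -> both p (n + e) (s + a) (m + b) ->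
  -4 <= s <= 4 /\ -4 <= m <= 4.
Proof. unfold both, upper, window; lia. Qed.

(** [H0] is the region at the parents. A cut with [rz >= 1] lies inside a block and can also be
    rounded up to its end; this passes a letter other than S, and [uz] tells whether it is M. Hence
    the extra bounds [Hz], [Hw], [Hzw]; [HG] comes from [separated]. *)
Lemma window_desubst p n s m m' rx ry rz rw uz uw :
  2 <= p -> -3 <= n <= 3 -> -4 <= s <= 4 -> -4 <= m <= 4 ->
  0 <= rx <= p -> 0 <= ry <= p -> 0 <= rz <= p -> 0 <= rw <= p ->
  m' = (p + 1) * s + m - n + rx + ry - rz - rw ->
  both p (s + m) m m' ->
  (1 <= rz -> 0 <= uz <= 1 /\ rz + uz <= p /\ both p (s + m - 1) m (m' - uz)) ->
  (1 <= rw -> 0 <= uw <= 1 /\ rw + uw <= p /\ both p (s + m - 1) m (m' - uw)) ->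
  (1 <= rz -> 1 <= rw -> both p (s + m - 2) m (m' - uz - uw)) ->
  (rz = p -> rw = p -> ~ (0 <= s + m <= 1 /\ m = -2 /\ m' = 2)) ->
  window p n s m.
Proof.
intros hp hn hs hm hx hy hz hw em H0 Hz Hw Hzw HG.
assert (Cz : rz = 0 \/ 1 <= rz) by lia.
assert (Cw : rw = 0 \/ 1 <= rw) by lia.
assert (Es : s = -4 \/ s = -3 \/ s = -2 \/ s = -1 \/ s = 0 \/ s = 1 \/ s = 2 \/ s = 3 \/ s = 4)
  by lia.
assert (Em : m = -4 \/ m = -3 \/ m = -2 \/ m = -1 \/ m = 0 \/ m = 1 \/ m = 2 \/ m = 3 \/ m = 4)
  by lia.
unfold both, upper, window in *.
destruct Es as [->|[->|[->|[->|[->|[->|[->|[->| ->]]]]]]]];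
destruct Em as [->|[->|[->|[->|[->|[->|[->|[->| ->]]]]]]]];
(* With [s] and [m] constant, all products with [p] are linear. Each pair is tried with [H0] alone,
   then split by whether [z] and [w] begin a block. *)
try (clear Hz Hw Hzw HG; lia).
all: destruct Cz as [Cz|Cz], Cw as [Cw|Cw];
 [ clear Hz Hw Hzw
 | specialize (Hw Cw); clear Hz Hzw
 | specialize (Hz Cz); clear Hw Hzw
 | specialize (Hw Cw); specialize (Hz Cz); specialize (Hzw Cz Cw) ];
 lia.
Qed.

Lemma upper_succ p n s m a b : 2 <= p -> 3 < n -> 0 <= a -> 0 <= b -> a + b <= 1 ->
  upper p (n - 1) (s - a) (m - b) -> upper p n s m.
Proof.
intros hp hn ha hb hab [_ h].
specialize (h ltac:(lia)); split; [lia | intros _].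
assert (a = 0 \/ a = 1) as [-> | ->] by lia; lia.
Qed.

(* Induction on the sum of the positions *)
Local Close Scope Z_scope.

(* With [x = i + a], [z = i], [w = j + b] and [y = j], this is the difference of the increments of
   [f] over the factors of length [a] at [i] and of length [b] at [j].  The order of the positions
   is irrelevant, which keeps the statements symmetric under exchanging [x, y] or [z, w]. *)
Definition disc (f : nat -> nat) (x y z w : nat) : Z :=
  (Z.of_nat (f x) + Z.of_nat (f y) - Z.of_nat (f z) - Z.of_nat (f w))%Z.

Definition balanced p x y z w : Prop :=
  upper (Z.of_nat p) (disc id x y z w) (disc (cnt p S) x y z w) (disc (cnt p M) x y z w).

(* The one fact about letters that the induction needs in addition to [balanced]. *)
Definition separated p x y z w : Prop :=
  u p z = L -> u p w = L ->
  ~ (disc (cnt p S) x y z w = (-2)%Z /\ disc (cnt p M) x y z w = 2%Z).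

Lemma separated_step p T x y z w : 1 < p ->
  (forall x y z w, x + y + z + w <= T -> balanced p x y z w) ->
  x + y + z.+1 + w.+1 <= T.+1 -> separated p x y z w.
Proof.
(* The parents [V], [W] of [z], [w] are not S, so moving past them gives [s = 2] and [n = -2]. *)
move=> hp bal le_T uz uw [eS eM].
have [X [a [_ [xS [xM [_ [_ [_ [_ [lex [ltx _]]]]]]]]]]] := parentP x hp.
have [Y [b [_ [yS [yM [_ [_ [_ [_ [ley [lty _]]]]]]]]]]] := parentP y hp.
have [V [c [_ [zS [zM [_ [_ [/(_ uz) zL [_ [lez [ltz _]]]]]]]]]]] := parentP z hp.
have [W [d [_ [wS [wM [_ [_ [/(_ uw) wL [_ [lew [ltw _]]]]]]]]]]] := parentP w hp.
have c0 a' : cnt p a' 0 = 0 by [].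
have pos : x + y + z + w > 0.
  case: (posnP (x + y + z + w)) => // /eqP; rewrite !addn_eq0 -!andbA => /and4P[].
  by move=> /eqP ex /eqP ey /eqP ez /eqP ew; move: eM; rewrite /disc ex ey ez ew !c0.
(* A positive position exceeds its parent, which gives the decrease by one needed here. *)
have le_T' : X + Y + V.+1 + W.+1 <= T by lia.
have [+ _] := bal _ _ _ _ le_T'.
rewrite /window /disc zL wL in eS eM *; rewrite /id; lia.
Qed.

Lemma disc_swap f x y z w : disc f z w x y = (- disc f x y z w)%Z.
Proof. by rewrite /disc; lia. Qed.

Definition both_balanced p x y z w : Prop :=
  both (Z.of_nat p) (disc id x y z w) (disc (cnt p S) x y z w) (disc (cnt p M) x y z w).

Lemma balanced_sym p T :
  (forall x y z w, x + y + z + w <= T -> balanced p x y z w) ->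
  forall x y z w, x + y + z + w <= T -> both_balanced p x y z w.
Proof.
move=> bal x y z w le_T; split; first exact: bal.
by rewrite -!(disc_swap _ x y z w); apply: bal; lia.
Qed.

Lemma disc_pred p x y z w : 0 < x + y -> exists x' y' (a b : Z),
  [/\ x' + y' + 1 = x + y, (0 <= a /\ 0 <= b /\ a + b <= 1)%Z,
      disc id x' y' z w = (disc id x y z w - 1)%Z,
      disc (cnt p S) x' y' z w = (disc (cnt p S) x y z w - a)%Z &
      disc (cnt p M) x' y' z w = (disc (cnt p M) x y z w - b)%Z].
Proof.
have half v v' : exists a b : Z, (0 <= a /\ 0 <= b /\ a + b <= 1)%Z /\
    (disc id v v' z w = (disc id v.+1 v' z w - 1)%Z /\
    disc (cnt p S) v v' z w = (disc (cnt p S) v.+1 v' z w - a)%Z /\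
    disc (cnt p M) v v' z w = (disc (cnt p M) v.+1 v' z w - b)%Z).
  exists (Z.of_nat (u p v == S)), (Z.of_nat (u p v == M)).
  by have le1 : (u p v == S) + (u p v == M) <= 1 by [case: (u p v)]; rewrite /disc !cntS /id; lia.
case: x y => [|x] [|y] // _.
- have [a [b [ab [en [es em]]]]] := half y 0;
    exists 0, y, a, b.
  by split; rewrite /disc in en es em * => //; lia.
- have [a [b [ab [en [es em]]]]] := half x 0;
    exists x, 0, a, b.
  by split; rewrite /disc in en es em * => //; lia.
- have [a [b [ab [en [es em]]]]] := half x y.+1;
    exists x, y.+1, a, b.
  by split; rewrite /disc in en es em * => //; lia.
Qed.

(** For [n > 3] one letter is removed; for [|n| <= 3] all four positions are desubstituted, unless
    none exceeds 1, where the prefixes contain only L. *)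
Lemma balanced_step p T x y z w : 1 < p ->
  (forall x y z w, x + y + z + w <= T -> balanced p x y z w) ->
  (forall x y z w, x + y + z.+1 + w.+1 <= T -> separated p x y z w) ->
  x + y + z + w <= T.+1 -> balanced p x y z w.
Proof.
move=> hp /balanced_sym bal sep le_T; rewrite /balanced.
set n := disc id _ _ _ _; set s := disc _ _ _ _ _; set m := disc _ _ _ _ _.
have down : 0 < x + y -> exists a b : Z, (0 <= a /\ 0 <= b /\ a + b <= 1 /\
    both (Z.of_nat p) (n - 1) (s - a) (m - b))%Z.
  case/(disc_pred p z w) => x' [y' [a [b [sum_eq [a0 [b0 ab]] en es em]]]].
  exists a, b; do 3!split=> //; rewrite -en -es -em; apply: bal; lia.
have up : 0 < z + w -> exists a b : Z, (0 <= a /\ 0 <= b /\ a + b <= 1 /\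
    both (Z.of_nat p) (n + 1) (s + a) (m + b))%Z.
  case/(disc_pred p x y) => z' [w' [a [b [sum_eq [a0 [b0 ab]] en es em]]]].
  exists a, b; do 3!split=> //.
  have -> : (n + 1 = disc id x y z' w')%Z by rewrite disc_swap en disc_swap; lia.
  have -> : (s + a = disc (cnt p S) x y z' w')%Z by rewrite disc_swap es disc_swap; lia.
  have -> : (m + b = disc (cnt p M) x y z' w')%Z by rewrite disc_swap em disc_swap; lia.
  apply: bal; lia.
have [n_gt3|n_le3] : (3 < n \/ n <= 3)%Z by lia.
  have xy_gt0 : 0 < x + y by rewrite /n /disc /id in n_gt3; lia.
  have [a [b [a0 [b0 [ab [bal' _]]]]]] := down xy_gt0.
  by apply: upper_succ bal' => //; lia.
suff core : (-3 <= n <= 3)%Z -> window (Z.of_nat p) n s m.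
  split=> // n_ge3; have n3 : n = 3%Z by lia.
  by have := core; rewrite /window n3; lia.
move=> n3.
have c1 a' v : a' != L -> v <= 1 -> cnt p a' v = 0.
  by case: v => [|[]] // a'L _; rewrite cntS u0 //; case: a' a'L.
have [small|big] : [&& x <= 1, y <= 1, z <= 1 & w <= 1] \/ [|| 1 < x, 1 < y, 1 < z | 1 < w] by lia.
  case/and4P: small => x1 y1 z1 w1.
  have -> : s = 0%Z by rewrite /s /disc !c1.
  have -> : m = 0%Z by rewrite /m /disc !c1.
  by rewrite /window; lia.
have [X [rx [xn [xS [xM [rxp [xL [_ [xr [lex [ltx lt1x]]]]]]]]]]] := parentP x hp.
have [Y [ry [yn [yS [yM [ryp [yL [_ [yr [ley [lty lt1y]]]]]]]]]]] := parentP y hp.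
have [V [rz [zn [zS [zM [rzp [zL [_ [zr [lez [ltz lt1z]]]]]]]]]]] := parentP z hp.
have [W [rw [wn [wS [wM [rwp [wL [_ [wr [lew [ltw lt1w]]]]]]]]]]] := parentP w hp.
(* A parent position equals the number of S and M before its child. *)
have en : disc id X Y V W = (s + m)%Z.
  by rewrite /s /m /disc /id; clear -xS yS zS wS xM yM zM wM; lia.
have es : disc (cnt p S) X Y V W = m by rewrite /m /disc; clear -xM yM zM wM; lia.
set m' := disc (cnt p M) X Y V W.
have em : m' = ((Z.of_nat p + 1) * s + m - n + Z.of_nat rx + Z.of_nat ry - Z.of_nat rz
    - Z.of_nat rw)%Z.
  rewrite /m' /n /s /m /disc /id.
  by clear -xn yn zn wn xS yS zS wS xM yM zM wM; nia.
(* [down] keeps [n] in range unless [n = -3], where [up] serves. In the remaining branch [xy_gt0]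
   states [x + y = 0], so [z + w <= 3] bounds the counts. *)
have [s4 m4] : (-4 <= s <= 4 /\ -4 <= m <= 4)%Z.
  have [xy_gt0|] := posnP (x + y); last first.
    move=> /down[a [b [a0 [b0 [ab bal']]]]].
    have [n2|n3'] : (-2 <= n \/ n = -3)%Z by clear -n3; lia.
      by apply: (@neighbour_bounds (Z.of_nat p) n s m (- a) (- b) (-1));
        try exact: bal'; clear -hp n3 n2 a0 b0 ab; lia.
    have /up[c [d [c0 [d0 [cd bal2]]]]] : 0 < z + w by rewrite /n /disc /id in n3'; clear -n3'; lia.
    by apply: (@neighbour_bounds (Z.of_nat p) n s m c d 1);
      try exact: bal2; clear -hp n3 n3' c0 d0 cd; lia.
  have sz := cnt_sum p z; have sw := cnt_sum p w; have sx := cnt_sum p x; have sy := cnt_sum p y.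
  rewrite /n /disc /id in n3; rewrite /s /m /disc.
  by clear -n3 xy_gt0 sx sy sz sw; lia.
have lt_sum : X + Y + V + W < x + y + z + w by clear -big lex lt1x ley lt1y lez lt1z lew lt1w; lia.
(* A position above 1 exceeds its parent by at least two, so the sum still drops after a step past
   [V] or [W]. *)
have zr1 : 0 < rz -> X + Y + V.+1 + W < x + y + z + w.
  by case/zr=> _ [_ [_ ltV]]; clear -ltV big lex lt1x ley lt1y lez lt1z lew lt1w; lia.
have wr1 : 0 < rw -> X + Y + V + W.+1 < x + y + z + w.
  by case/wr=> _ [_ [_ ltW]]; clear -ltW big lex lt1x ley lt1y lez lt1z lew lt1w; lia.
have zwr1 : 0 < rz -> 0 < rw -> X + Y + V.+1 + W.+1 < x + y + z + w.
  case/zr=> _ [_ [_ ltV]] /wr[_ [_ [_ ltW]]].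
  by clear -ltV ltW big lex lt1x ley lt1y lez lt1z lew lt1w; lia.
apply: (@window_desubst _ n s m m' (Z.of_nat rx) (Z.of_nat ry) (Z.of_nat rz) (Z.of_nat rw)
  (Z.of_nat (u p V == M)) (Z.of_nat (u p W == M))) => //.
- by clear -hp; lia.
- by clear -rxp; lia.
- by clear -ryp; lia.
- by clear -rzp; lia.
- by clear -rwp; lia.
- by rewrite -en -es; apply: bal; clear -le_T lt_sum; lia.
- move=> rz_gt0; have {}rz_gt0 : 0 < rz by clear -rz_gt0; lia.
  have [VS [VM [rzd ltV]]] := zr rz_gt0.
  do 2?split; [by case: (_ == _)..|by clear -rzd; lia|].
  have := bal _ _ _ _ (leq_trans (zr1 rz_gt0) le_T); rewrite /both_balanced.
  have -> : disc id X Y V.+1 W = (s + m - 1)%Z by rewrite -en /disc /id; clear; lia.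
  have -> : disc (cnt p S) X Y V.+1 W = m by rewrite -es /disc VS.
  have -> : disc (cnt p M) X Y V.+1 W = (m' - Z.of_nat (u p V == M))%Z
    by rewrite /m' /disc VM; clear; lia.
  by [].
- move=> rw_gt0; have {}rw_gt0 : 0 < rw by clear -rw_gt0; lia.
  have [WS [WM [rwd ltW]]] := wr rw_gt0.
  do 2?split; [by case: (_ == _)..|by clear -rwd; lia|].
  have := bal _ _ _ _ (leq_trans (wr1 rw_gt0) le_T); rewrite /both_balanced.
  have -> : disc id X Y V W.+1 = (s + m - 1)%Z by rewrite -en /disc /id; clear; lia.
  have -> : disc (cnt p S) X Y V W.+1 = m by rewrite -es /disc WS.
  have -> : disc (cnt p M) X Y V W.+1 = (m' - Z.of_nat (u p W == M))%Z
    by rewrite /m' /disc WM; clear; lia.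
  by [].
- move=> rz_gt0 rw_gt0; have {}rz_gt0 : 0 < rz by clear -rz_gt0; lia.
  have {}rw_gt0 : 0 < rw by clear -rw_gt0; lia.
  have [[VS [VM _]] [WS [WM _]]] := (zr rz_gt0, wr rw_gt0).
  have := bal _ _ _ _ (leq_trans (zwr1 rz_gt0 rw_gt0) le_T); rewrite /both_balanced.
  have -> : disc id X Y V.+1 W.+1 = (s + m - 2)%Z by rewrite -en /disc /id; clear; lia.
  have -> : disc (cnt p S) X Y V.+1 W.+1 = m by rewrite -es /disc VS WS.
  have -> : disc (cnt p M) X Y V.+1 W.+1 =
      (m' - Z.of_nat (u p V == M) - Z.of_nat (u p W == M))%Z
    by rewrite /m' /disc VM WM; clear; lia.
  by [].
- move=> rz_p rw_p [n01 [mN2 m'2]].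
  have {}rz_p : rz = p by clear -rz_p; lia.
  have {}rw_p : rw = p by clear -rw_p; lia.
  have p_gt0 : 0 < p by clear -hp; lia.
  have le_T' : X + Y + V.+1 + W.+1 <= T.
    by apply: leq_trans (zwr1 _ _) le_T; rewrite ?rz_p ?rw_p.
  (* Place [p] exists only in the image of L, so [V] and [W] carry L. *)
  apply: (sep _ _ _ _ le_T' (zL rz_p) (wL rw_p)).
  by split; rewrite ?es // -mN2.
Qed.

(** Both properties rest on smaller sums only, hence one simultaneous induction. *)
Lemma balancedP p x y z w : 1 < p -> both_balanced p x y z w.
Proof.
move=> hp; suff H T : (forall x y z w, x + y + z + w <= T -> balanced p x y z w) /\
    (forall x y z w, x + y + z.+1 + w.+1 <= T -> separated p x y z w).
  exact: balanced_sym (H _).1 _ _ _ _ (leqnn _).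
elim: T => [|T [bal sep]]; last first.
  split=> {}x {}y {}z {}w; first exact: balanced_step.
  exact: separated_step.
split=> [{}x {}y {}z {}w|]; last by move=> *; lia.
rewrite leqn0 !addn_eq0 -!andbA => /and4P[/eqP-> /eqP-> /eqP-> /eqP->].
have d0 f : f 0 = 0 -> disc f 0 0 0 0 = 0%Z by rewrite /disc => ->.
by rewrite /balanced !d0 //; split; rewrite /window; clear; lia.
Qed.

(** * The upper bound 7 *)

(** At [n = 0] and [s = 2] the first clause of [window] reads [2 (p + 1) + m <= 2 p + 2]. *)
Lemma both0 p s m : (2 <= p -> both p 0 s m ->
  -2 <= s <= 2 /\ -2 <= m <= 2 /\ (s = 2 -> m <= 0))%Z.
Proof.
move=> hp [up lo]; have {}up := up.1 ltac:(lia); have {}lo := lo.1 ltac:(lia).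
rewrite /window in up lo.
have [e|[e|s2]] : (s = 3 \/ s = -3 \/ -2 <= s <= 2)%Z by lia.
- by rewrite e in up lo; lia.
- by rewrite e in up lo; lia.
by split=> //; split; [lia | move=> e; rewrite e in up; lia].
Qed.

Lemma parikh_diff p i j n : 1 < p -> let c a k := count_mem a (factor p k n) in
  c S i <= c S j + 2 /\ c M i <= c M j + 2 /\ (c S i = c S j + 2 -> c M i <= c M j).
Proof.
move=> hp c; have := balancedP (i + n) j i (j + n) hp; rewrite /both_balanced.
have -> : disc id (i + n) j i (j + n) = 0%Z by rewrite /disc /id; lia.
have dE a : disc (cnt p a) (i + n) j i (j + n) = (Z.of_nat (c a i) - Z.of_nat (c a j))%Z.
  by rewrite /disc !cnt_factor /c; lia.
by rewrite !dE => /both0; lia.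
Qed.

Lemma size_factor p i n : size (factor p i n) = n.
Proof. by rewrite size_map size_iota. Qed.

Lemma abelian_complexity_le7 p n : 1 < p -> abelian_complexity p n <= 7.
Proof.
move=> hp; rewrite /abelian_complexity; set A := [set v | _].
pose s (v : 'I_n.+1 * 'I_n.+1 * 'I_n.+1) : nat := v.1.2.
pose m (v : 'I_n.+1 * 'I_n.+1 * 'I_n.+1) : nat := v.2.
have A_sum v : v \in A -> v.1.1 + s v + m v = n.
  by rewrite inE /s /m => /asboolP[i [<- <- <-]]; rewrite count_letters size_factor.
have A_diff v w : v \in A -> w \in A ->
    s v <= s w + 2 /\ m v <= m w + 2 /\ (s v = s w + 2 -> m v <= m w).
  rewrite !inE /s /m => /asboolP[i [_ <- <-]] /asboolP[j [_ <- <-]].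
  exact: parikh_diff.
have [-> | [v0 Av0]] := set_0Vmem A; first by rewrite cards0.
have [a Aa a_min] := arg_minnP s Av0.
have [b Ab b_min] := arg_minnP m Av0.
(* Two columns at distance 2 share at most one height, so shifting the last column by one
   position against the first packs the three columns into 3 + 4 codes. *)
pose code v := if s v == (s a).+1 then m v - m b else
  if s v == s a then 4 + (m v - m b) else 3 + (m v - m b).
have code_lt v : v \in A -> code v < 7.
  move=> Av; have := A_diff v a Av Aa; have := A_diff v b Av Ab.
  have := a_min v Av; have := b_min v Av; rewrite /code.
  by do 2?case: eqP => ?; lia.
have code_inj : {in A &, injective (fun v => inord (code v) : 'I_7)}.
  move=> v w Av Aw /(congr1 val); rewrite /= !inordK ?code_lt // => eq_code.
  have [eq_s eq_m] : s v = s w /\ m v = m w.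
    have := A_diff v w Av Aw; have := A_diff w v Aw Av.
    have := A_diff v a Av Aa; have := A_diff w a Aw Aa.
    have := A_diff v b Av Ab; have := A_diff w b Aw Ab.
    move: (a_min v Av) (a_min w Aw) (b_min v Av) (b_min w Aw) eq_code; rewrite /code.
    by do 4?case: eqP => ?; lia.
  have := A_sum w Aw; have := A_sum v Av; rewrite eq_s eq_m => sum_v sum_w.
  rewrite (surjective_pairing v) (surjective_pairing w).
  rewrite (surjective_pairing v.1) (surjective_pairing w.1).
  by congr (_, _, _); apply: val_inj => //=; apply/eqP;
    rewrite -(eqn_add2r (s w + m w)) !addnA sum_v sum_w.
by rewrite -(card_in_imset code_inj) (leq_trans (max_card _)) ?card_ord.
Qed.

(** * Seven factors of equal length, for infinitely many lengths *)

Lemma abelian_complexity_ge p n (js : seq nat) :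
  uniq [seq parikh (factor p j n) | j <- js] -> size js <= abelian_complexity p n.
Proof.
rewrite /abelian_complexity; set A := [set v | _] => uniq_js.
pose c a j := count_mem a (factor p j n).
pose v j : 'I_n.+1 * 'I_n.+1 * 'I_n.+1 := (inord (c L j), inord (c S j), inord (c M j)).
have c_lt a j : c a j < n.+1 by rewrite ltnS -[leqRHS](size_factor p j n) count_size.
have vE j : parikh (factor p j n) = (val (v j).1.1, val (v j).1.2, val (v j).2).
  by rewrite /v /= !inordK.
have uniq_v : uniq (map v js).
  have pE : map (fun j => parikh (factor p j n)) js =
      map (fun t : 'I_n.+1 * 'I_n.+1 * 'I_n.+1 => (val t.1.1, val t.1.2, val t.2)) (map v js).
    by rewrite -map_comp; apply: eq_map => j; rewrite vE.
  by move: uniq_js; rewrite pE => /map_uniq.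
rewrite -(size_map v) -(card_uniqP uniq_v); apply/subset_leq_card/subsetP=> _ /mapP[j _ ->].
by rewrite inE; apply/asboolP; exists j.
Qed.

(* A path [(r_1, a_1); ...] descends from a letter of [u] to the letter [a_1] at place [r_1]
   of its image, then to the letter [a_2] at place [r_2] of the image of that letter, etc. *)
Fixpoint path_ok (p : Z) (a : letter) (ds : seq (Z * letter)) : Prop :=
  if ds is (r, b) :: ds' then
    match a, b with
    | L, L => (0 <= r < p)%Z
    | L, S => r = p
    | S, M => r = 0%Z
    | M, L => (0 <= r < p - 1)%Z
    | M, S => r = (p - 1)%Z
    | _, _ => False
    end /\ path_ok p b ds'
  else True.

(** The equations of [child_of] solved for the child: [v] holds a position and the numbers of S and
    M before it. Over [Z] the map is affine. *)
Fixpoint descend (p : Z) (ds : seq (Z * letter)) (v : Z * Z * Z) : Z * Z * Z :=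
  if ds is (r, _) :: ds' then
    let: (n, s, m) := v in descend p ds' ((p + 1) * n - p * s - m + r, n - s, s)%Z
  else v.

Definition prefix_vec p i : Z * Z * Z :=
  (Z.of_nat i, Z.of_nat (cnt p S i), Z.of_nat (cnt p M i)).

Lemma descend_reach p ds N : 1 < p -> path_ok (Z.of_nat p) (u p N) ds ->
  exists2 i, N <= i & prefix_vec p i = descend (Z.of_nat p) ds (prefix_vec p N).
Proof.
move=> hp; elim: ds N => [|[r b] ds IHds] N /=; first by exists N.
case=> r_ok ds_ok.
have [r' r_eq [r_lt nth_r]] : exists2 r' : nat, r = Z.of_nat r' &
    r' < size (phi p (u p N)) /\ nth L (phi p (u p N)) r' = b.
  exists (Z.to_nat r); first by case: (u p N) b r_ok {ds_ok} => [] []; lia.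
  case: (u p N) b r_ok {ds_ok} => [] [] //= r_ok; rewrite ?size_rcons ?size_nseq ?r_ok //;
    rewrite ?nth_rcons ?size_nseq ?nth_nseq; split; try lia; do 2?case: ifP => //; lia.
have [_ i_eq S_eq M_eq u_i] := block_child hp r_lt.
set i := size _ + r' in i_eq S_eq M_eq u_i.
have le_N : N <= i.
  by have := size_phiw_ge (pre p N) hp; rewrite size_mkseq /i; lia.
have [|j le_j j_eq] := IHds i; first by rewrite u_i nth_r.
exists j; first exact: leq_trans le_j.
by rewrite j_eq; congr descend; rewrite /prefix_vec; congr (_, _, _); lia.
Qed.

(** As [p > 1], the image of L has an L at place 1, so an L at [N] yields one further right. *)
Lemma u_L_unbounded p K : 1 < p -> exists2 N, K <= N & u p N = L.
Proof.
move=> hp; elim: K => [|K [N le_N uN]]; first by exists 0 => //; apply: u0.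
have r_lt : 1 < size (phi p (u p N)) by rewrite uN /= size_rcons size_nseq; lia.
have [_ _ _ _ u_i] := block_child hp r_lt.
exists (size (phiw p (pre p N)) + 1).
  by have := size_phiw_ge (pre p N) hp; rewrite size_mkseq; lia.
by rewrite u_i uN /= nth_rcons size_nseq hp nth_nseq hp.
Qed.

(* From [N = 0] it leads to the prefix of length [|phi^4(L)| + |phi^3(L)|]. *)
Definition shift_path : seq (Z * letter) :=
  [:: (0, L); (0, L); (1, L); (1, L); (0, L); (0, L); (0, L)]%Z.

(** The path [xs] from 0 ends at [i] and [ys] from [N] ends at [i + n]; the difference of the two
    prefixes is the factor. *)
Lemma factor_vec p N xs ys n s m : 1 < p -> u p N = L -> let P := Z.of_nat p in
  path_ok P L xs -> path_ok P L ys ->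
  descend P ys (prefix_vec p N) =
    (let: (a, b, c) := descend P xs (0, 0, 0)%Z in (a + Z.of_nat n, b + s, c + m)%Z) ->
  exists i, Z.of_nat (count_mem S (factor p i n)) = s /\
            Z.of_nat (count_mem M (factor p i n)) = m.
Proof.
move=> hp uN P xs_ok ys_ok eq_v.
have [|i _ i_eq] := @descend_reach p xs 0 hp; first by rewrite u0.
have [|j _ j_eq] := @descend_reach p ys N hp; first by rewrite uN.
move: j_eq; rewrite eq_v -[(0, 0, 0)%Z]/(prefix_vec p 0) -i_eq => -[eN eS eM].
have j_in : j = i + n by lia.
by exists i; rewrite j_in !cnt_factor in eS eM; lia.
Qed.

Lemma seven_factors p N : 1 < p -> u p N = L ->
  exists2 n, N <= n & exists2 js, size js = 7 & uniq [seq parikh (factor p j n) | j <- js].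
Proof.
move=> hp uN; set P := Z.of_nat p; have P_gt1 : (2 <= P)%Z by lia.
have [|n le_n n_eq] := @descend_reach p shift_path N hp; first by rewrite uN /=; lia.
exists n => //; move: n_eq; rewrite -/P.
have vec := @factor_vec p N _ _ n _ _ hp uN; rewrite -/P in vec.
move: vec; case: (prefix_vec p N) => [[N' s'] m'] vec.
rewrite {1}/prefix_vec.
set s0 := Z.of_nat (cnt p S n); set m0 := Z.of_nat (cnt p M n) => n_eq.
(* For [p = 2] the digit [2] marks the final letter of [phi p L]. *)
pose b := if (P =? 2)%Z then S else L; pose c := if (P =? 2)%Z then M else L.
have bc : P = 2%Z /\ b = S /\ c = M \/ (2 < P)%Z /\ b = L /\ c = L.
  by rewrite /b /c; case: Z.eqb_spec => ?; [left | right]; split => //; lia.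
(* Each [ys] below has seven digits, like [shift_path]. The linear part of [descend] depends only on
   that number, so [N'], [s'], [m'] cancel and [ring] concludes. *)
have wit ds dm xs ys : path_ok P L xs -> path_ok P L ys ->
    descend P ys (N', s', m') = (let: (a, b, c) := descend P xs (0, 0, 0)%Z in
      let: (n, s, m) := descend P shift_path (N', s', m') in (a + n, b + s + ds, c + m + dm)%Z) ->
    exists i, Z.of_nat (count_mem S (factor p i n)) = (s0 + ds)%Z /\
              Z.of_nat (count_mem M (factor p i n)) = (m0 + dm)%Z.
  move=> xs_ok ys_ok; rewrite -n_eq => eq_v; apply: vec xs_ok ys_ok _; rewrite eq_v.
  by case: descend => [[a b'] c']; rewrite !Z.add_assoc.
(* The offsets [(ds, dm)] from the prefix of length [n] are the origin and six points around it, in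
   columns of sizes 2, 3, 2. *)
have [i1 [s1 m1]] := wit (-1)%Z 0%Z
  [:: (P, S); (0, M); (P - 1, S); (0, M); (0, L); (0, L)]%Z
  [:: (1, L); (0, L); (1, L); (0, L); (P - 1, L); (1, L); (P, S)]%Z
  ltac:(by move=> /=; lia) ltac:(by move=> /=; lia) ltac:(by move=> /=; do ![congr (_, _)]; ring).
have [i2 [s2 m2]] := wit (-1)%Z 1%Z
  [:: (P - 1, L); (0, L); (P, S); (0, M)]%Z
  [:: (0, L); (0, L); (2, b); (0, c); (0, L); (0, L); (P, S)]%Z
  ltac:(by move=> /=; lia) ltac:(by case: bc => [[?]|[?]] [eb ec]; rewrite ?eb ?ec /=; lia)
  ltac:(by move=> /=; do ![congr (_, _)]; ring).
have [i3 [s3 m3]] := wit 0%Z (-1)%Z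
  [:: (P - 1, L); (0, L); (P, S); (0, M); (0, L)]%Z
  [:: (0, L); (1, L); (0, L); (1, L); (0, L); (P - 1, L); (2, b)]%Z
  ltac:(by move=> /=; lia) ltac:(by case: bc => [[?]|[?]] [eb ec]; rewrite ?eb ?ec /=; lia)
  ltac:(by move=> /=; do ![congr (_, _)]; ring).
have [i4 [s4 m4]] := wit 0%Z 0%Z [::] shift_path
  ltac:(by move=> /=; lia) ltac:(by move=> /=; lia) ltac:(by move=> /=; do ![congr (_, _)]; ring).
have [i5 [s5 m5]] := wit 0%Z 1%Z
  [:: (P - 1, L); (0, L); (P - 1, L); (1, L)]%Z
  [:: (0, L); (0, L); (2, b); (0, c); (0, L); (0, L); (0, L)]%Z
  ltac:(by move=> /=; lia) ltac:(by case: bc => [[?]|[?]] [eb ec]; rewrite ?eb ?ec /=; lia)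
  ltac:(by move=> /=; do ![congr (_, _)]; ring).
have [i6 [s6 m6]] := wit 1%Z (-1)%Z
  [:: (P - 1, L); (0, L); (P, S); (0, M); (P - 1, S)]%Z
  [:: (0, L); (1, L); (0, L); (1, L); (0, L); (P, S); (0, M)]%Z
  ltac:(by move=> /=; lia) ltac:(by move=> /=; lia) ltac:(by move=> /=; do ![congr (_, _)]; ring).
have [i7 [s7 m7]] := wit 1%Z 0%Z
  [:: (P - 1, L); (0, L); (P - 1, L); (0, L); (P, S)]%Z
  [:: (0, L); (1, L); (0, L); (1, L); (0, L); (0, L); (0, L)]%Z
  ltac:(by move=> /=; lia) ltac:(by move=> /=; lia) ltac:(by move=> /=; do ![congr (_, _)]; ring).
exists [:: i1; i2; i3; i4; i5; i6; i7] => //=; rewrite !inE !negb_or.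
have neq i j : (count_mem S (factor p i n), count_mem M (factor p i n)) !=
    (count_mem S (factor p j n), count_mem M (factor p j n)) ->
    parikh (factor p i n) != parikh (factor p j n).
  by apply: contraNneq => -[_ -> ->].
by do ![apply/andP; split]; rewrite // neq // xpair_eqE; lia.
Qed.

Theorem theorem8p3 (p : nat) (hp : 1 < p) :
  (forall n : nat, abelian_complexity p n <= 7) /\
  (forall N : nat, exists n : nat, N <= n /\ abelian_complexity p n = 7).
Proof.
split=> [n | K]; first exact: abelian_complexity_le7.
have [N le_N uN] := u_L_unbounded K hp; have [n le_n [js size_js uniq_js]] := seven_factors hp uN.
exists n; split; first exact: leq_trans le_n.
by apply/eqP; rewrite eqn_leq abelian_complexity_le7 // -[X in X <= _]size_js abelian_complexity_ge.
Qed.
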